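(* (i) (Seki and Yamamoto) One has $$\zeta(3)=\sum_{n_1,n_2\ge 1}\frac{1}{n_1n_2}\cdot\frac{1\cdot 2\cdots n_2}{n_1(n_1+1)\cdots(n_1+n_2)}.$$ For integers $k,l\ge 1$, $$\sum_{n_1,n_2\ge 1}\frac{1}{n_1^kn_2^l}\cdot\frac{1\cdot 2\cdots n_2}{n_1(n_1+1)\cdots(n_1+n_2)}=\begin{cases}\zeta(k+1,\underbrace{1,1,\dots,1}_{l-2},2) & \text{if } l\ge 2,\\ \zeta(k+2) & \text{if } l=1,\end{cases}$$ and $$\zeta(k+l+1)=\sum_{n_1\ge 1,\ 0<m_1<m_2<\cdots<m_l}\frac{1}{n_1^k m_1m_2\cdots m_l}\cdot\frac{1\cdot 2\cdots m_l}{n_1(n_1+1)\cdots(n_1+m_l)}.$$ (ii) For integers $k_1,k_2,\dots,k_r\ge 1$, the series $$\sum_{n_1,n_2,\dots,n_r\ge 1}\frac{1}{n_1^{k_1}n_2^{k_2}\cdots n_r^{k_r}}\cdot\frac{1}{n_1(n_1+n_2)\cdots(n_1+n_2+\cdots+n_r)}$$ and $$\sum_{\substack{n_1,n_2,\dots,n_r\ge 1\\ n_i<m_i,\ 1\le i\le r}}\frac{1}{n_1^{k_1}n_2^{k_2}\cdots n_r^{k_r}}\cdot\frac{1}{m_1(m_1+m_2)\cdots(m_1+m_2+\cdots+m_{r-1})(m_1+m_2+\cdots+m_r)^2}$$ (the second sum being over all integers $n_1,\dots,n_r\ge 1$ and all integers $m_1,\dots,m_r$ with $n_i<m_i$ for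 $1\le i\le r$) are convergent, and their values are in the algebra of multiple zeta values.
   Context: A multiple zeta value is $\zeta(k_1,\dots,k_r)=\sum_{0<n_1<\cdots<n_r}\frac{1}{n_1^{k_1}\cdots n_r^{k_r}}$ with $r\ge 1$, integers $k_1,\dots,k_{r-1}\ge 1$ and $k_r\ge 2$ (so the largest summation index carries the last exponent). The algebra of multiple zeta values is the $\mathbb{Q}$-subalgebra of $\mathbb{R}$ generated by all multiple zeta values. All summation indices are integers. The numerators $1\cdot 2\cdots n_2$ and $1\cdot 2\cdots m_l$ are the factorials $n_2!$ and $m_l!$, and the denominators $n_1(n_1+1)\cdots(n_1+n_2)$ and $n_1(n_1+1)\cdots(n_1+m_l)$ are products of consecutive integers. The notation $\underbrace{1,\dots,1}_{l-2}$ means $l-2$ entries equal to $1$ (none if $l=2$). *)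

(* Defs.v *)
From HB Require Import structures.
From mathcomp Require Import all_boot all_order all_algebra.
From mathcomp Require Import all_classical all_reals all_analysis.

Set Implicit Arguments.
Unset Strict Implicit.
Unset Printing Implicit Defensive.
Import Order.TTheory GRing.Theory Num.Theory.
Local Open Scope classical_set_scope.
Local Open Scope ring_scope.

(* All series below have nonnegative terms and are summed, unordered, with
   [\esum] in [\bar R]; convergence is [summable]. *)

(* [path ltn 0 n] says 0 < n_1 < ... < n_r. *)
Definition increasing_indices (r : nat) : set (r.-tuple nat) :=
  [set n : r.-tuple nat | path ltn 0%N n].
Arguments increasing_indices r : clear implicits.

Definition inv_powers (R : realType) (r : nat) (k n : r.-tuple nat) : R :=
  \prod_(i < r) ((tnth n i)%:R ^+ tnth k i)^-1.

Definition mzv (R : realType) (r : nat) (k : r.-tuple nat) : R :=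
  fine (\esum_(n in increasing_indices r) (inv_powers R k n)%:E).

Definition admissible (r : nat) (k : r.-tuple nat) : Prop :=
  [/\ (1 <= r)%N, (forall i, 1 <= tnth k i)%N & (2 <= last 0%N k)%N].

Definition Qsubalgebra (R : realType) (A : set R) : Prop :=
  [/\ A 1,
      forall x y, A x -> A y -> A (x + y),
      forall x y, A x -> A y -> A (x * y) &
      forall (q : rat) x, A x -> A (ratr q * x)].

Definition mzv_algebra (R : realType) : set R :=
  smallest (@Qsubalgebra R)
    [set x : R | exists (r : nat) (k : r.-tuple nat),
       admissible k /\ x = mzv R k].
Arguments mzv_algebra R : clear implicits.

(* b! / (a (a+1) ... (a+b)) *)
Definition fact_ratio (R : realType) (a b : nat) : R :=
  b`!%:R / \prod_(0 <= i < b.+1) (a + i)%N%:R.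

(* m_1 + ... + m_(j+1), the index j starting at 0 *)
Definition partial_sum (r : nat) (m : r.-tuple nat) (j : nat) : nat :=
  (\sum_(i < r | i <= j) tnth m i)%N.

(* Main.v *)
Require Import Defs.
From HB Require Import structures.
From mathcomp Require Import all_boot all_order all_algebra.
From mathcomp Require Import all_classical all_reals all_analysis.
From mathcomp Require Import ring.

Set Implicit Arguments.
Unset Strict Implicit.
Unset Printing Implicit Defensive.
Import Order.TTheory GRing.Theory Num.Theory.
Import numFieldNormedType.Exports.
Local Open Scope classical_set_scope.
Local Open Scope ring_scope.

(** Every sum here has nonnegative terms, so it may be rearranged freely, its
    value being possibly infinite; finiteness is needed only to get a real
    number at the end.

    All the multiple sums run along chains 0 = N_0 < N_1 < ... < N_r, weighted
    by a product of kernels K k_i N_(i-1) N_i.  For a multiple zeta value the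
    N_i are the summation indices; for the two series with denominators built
    on partial sums they are n_1 + ... + n_i and m_1 + ... + m_i.  Such a sum
    can be evaluated from the top index down, by operators on functions
    ([transfer]), or from the bottom up, by the adjoint operators on sequences
    ([push]); the two agree by [transfers_adjoint].

    The double series are evaluated with the Seki-Yamamoto connector
    C(a, b) = a! b! / (a + b)!, for which the sum of C(c, b) / c over c > a
    telescopes to C(a, b) / b when b > 0 ([transport]).  Since
    b! / (a (a+1) ... (a+b)) = C(a, b) / a, each identity follows by applying
    [transport] repeatedly, moving one factor at a time across the connector.
    The same computation with a = 0 turns zeta(1, ..., 1, 2) into a sum of
    1 / b^(j + 2), and this dominates every multiple zeta value of the same
    depth ([transfers_admissible_lty]).

    For the series with partial sums, the adjoint operators are convolutions
    followed by a division by N.  The coefficient sequences of multiple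
    polylogarithms are stable under convolution: this is the shuffle product
    ([polylog_coef_conv]), which on coefficients is the partial fraction
    identity 1 / (i j) = (1 / i + 1 / j) / (i + j).  So both series have the
    form sum over N of f(N) / N with f such a sequence, and the division by N
    makes the last exponent at least 2: the value is a sum of convergent
    multiple zeta values ([esum_polylog_coef]). *)

(** * Unordered sums of nonnegative terms *)

Lemma esumZl (R : realType) (T : choiceType) (I : set T) (c : R)
    (a : T -> \bar R) : 0 <= c -> (forall i, 0 <= a i)%E ->
  (\esum_(i in I) (c%:E * a i) = c%:E * \esum_(i in I) a i)%E.
Proof.
have le (d : R) (b : T -> \bar R) : 0 <= d -> (forall i, 0 <= b i)%E ->
    (\esum_(i in I) (d%:E * b i) <= d%:E * \esum_(i in I) b i)%E.
  move=> d0 b0; apply: ge_ereal_sup => _ /= [X [finX XI]] <-.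
  rewrite -ge0_mule_fsumr//; apply: lee_wpmul2l; first by rewrite lee_fin.
  by apply: ereal_sup_ubound; exists X.
rewrite le_eqVlt => /predU1P[<- _|c0 a0].
  by rewrite mul0e esum1// => i _; rewrite mul0e.
(* The converse inequality is the first one for the inverse of c. *)
apply/eqP; rewrite eq_le le ?(ltW c0)//=.
have ca0 i : (0 <= c%:E * a i)%E by rewrite mule_ge0// lee_fin ltW.
have cV0 : 0 <= c^-1 by rewrite invr_ge0 ltW.
have c0E : (0 <= c%:E)%E by rewrite lee_fin ltW.
have := lee_wpmul2l c0E (le c^-1 _ cV0 ca0).
rewrite [leRHS]muleA -EFinM divff ?gt_eqF// mul1e.
by under eq_esum do rewrite muleA -EFinM mulVf ?gt_eqF// mul1e.
Qed.

Lemma esum_ord (R : realType) n (a : nat -> \bar R) :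
  (forall i, 0 <= a i)%E ->
  (\esum_(i in [set i | (i < n)%N]) a i = \sum_(i < n) a i)%E.
Proof.
move=> a0; rewrite -(nneseries_esum (P := fun i => (i < n)%N))//.
rewrite (@nneseries_split_cond _ _ 0 n)// add0n big_mkord big_mkcond/=.
rewrite [X in (_ + X)%E]eseries0 ?adde0; last first.
  by move=> i ni; rewrite ltnNge ni.
by apply: eq_bigr => i _; rewrite ltn_ord.
Qed.

Lemma esum_supp1 (R : realType) (T : choiceType) (x : T) (a : T -> \bar R) :
  (0 <= a x)%E -> (forall y, y != x -> a y = 0%E) ->
  (\esum_(y in setT) a y = a x)%E.
Proof.
move=> ax0 a0; rewrite -(@esum_set1 _ _ x a)// [RHS]esum_mkcond.
apply: eq_esum => y _; case: ifPn => //; rewrite notin_setE/= => /eqP.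
by move=> /a0.
Qed.

Lemma esum_exchange (R : realType) (T1 T2 : choiceType) (I : set T1)
    (J : set T2) (P : T1 -> T2 -> Prop) (a : T1 -> T2 -> \bar R) :
  (forall i j, I i -> J j -> P i j -> 0 <= a i j)%E ->
  (\esum_(i in I) \esum_(j in [set j | J j /\ P i j]) a i j =
   \esum_(j in J) \esum_(i in [set i | I i /\ P i j]) a i j)%E.
Proof.
move=> a0; rewrite !esum_esum; last 2 first.
- by move=> j i Jj [Ii Pij]; apply: a0.
- by move=> i j Ii [Jj Pij]; apply: a0.
apply: (reindex_esum _ _ (fun x => (x.2, x.1))); split.
- by move=> [j i] [/= Jj [Ii Pij]].
- by move=> [j i] [j' i'] _ _ [-> ->].
- by move=> [i j] [/= Ii [Jj Pij]]; exists (j, i).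
Qed.

Lemma esum_tuple0 (R : realType) (T : choiceType) (D : set (0.-tuple T))
    (a : 0.-tuple T -> \bar R) : D [tuple] -> (0 <= a [tuple])%E ->
  (\esum_(n in D) a n = a [tuple])%E.
Proof.
move=> D0 a0; rewrite -(@esum_set1 _ _ [tuple] a)//; congr (esum _ _).
by apply/seteqP; split=> n /=; rewrite (tuple0 n).
Qed.

Lemma esum_tuple_cons (R : realType) (T : choiceType) r
    (D : set (r.+1.-tuple T)) (I : set T) (D' : T -> set (r.-tuple T))
    (a : r.+1.-tuple T -> \bar R) : (forall n, 0 <= a n)%E ->
  (forall (x : T) (n : r.-tuple T), D [tuple of x :: n] <-> I x /\ D' x n) ->
  (\esum_(n in D) a n =
   \esum_(x in I) \esum_(n in D' x) a [tuple of x :: n])%E.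
Proof.
move=> a0 HD; rewrite esum_esum//.
apply: (reindex_esum _ _ (fun y : T * r.-tuple T => [tuple of y.1 :: y.2]));
  split.
- by move=> [x n] /= [Ix D'n]; apply/HD.
- by move=> [x n] [y m] _ _ /= /(congr1 val)/= [-> /val_inj ->].
- by move=> n; case/tupleP: n => x n /HD[Ix D'n]; exists (x, n).
Qed.

(** The two tuples of a pair are built up simultaneously. *)
Lemma esum_tuple_cons2 (R : realType) (T U : choiceType) r
    (D : set (r.+1.-tuple T * r.+1.-tuple U)) (I : set (T * U))
    (D' : set (r.-tuple T * r.-tuple U))
    (a : r.+1.-tuple T * r.+1.-tuple U -> \bar R) : (forall n, 0 <= a n)%E ->
  (forall (x : T) (y : U) (n : r.-tuple T) (m : r.-tuple U),
     D ([tuple of x :: n], [tuple of y :: m]) <-> I (x, y) /\ D' (n, m)) ->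
  (\esum_(z in D) a z =
   \esum_(x in I) \esum_(z in D')
     a ([tuple of x.1 :: z.1], [tuple of x.2 :: z.2]))%E.
Proof.
move=> a0 HD; rewrite esum_esum//.
apply: (reindex_esum _ _ (fun y : (T * U) * (r.-tuple T * r.-tuple U) =>
   ([tuple of y.1.1 :: y.2.1], [tuple of y.1.2 :: y.2.2]))); split.
- by move=> [[x y] [n m]] /= [Ix D'n]; apply/HD.
- move=> [[x y] [n m]] [[x' y'] [n' m']] _ _ /=.
  move=> /(congr1 (fun z => (val z.1, val z.2)))/=.
  by move=> [-> /val_inj -> -> /val_inj ->].
- move=> [n m]; case/tupleP: n => x n; case/tupleP: m => y m /HD[Ix D'n].
  by exists ((x, y), (n, m)).
Qed.

Lemma esum_gt_shift (R : realType) s (a : nat -> \bar R) :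
  (\esum_(N in [set N | (s < N)%N]) a N =
   \esum_(n in [set n | (0 < n)%N]) a (s + n)%N)%E.
Proof.
apply: reindex_esum; split.
- by move=> n /= n0; rewrite -addn1 leq_add2l.
- by move=> n m _ _ /addnI.
- by move=> N /= sN; exists (N - s)%N; rewrite /= ?subn_gt0// subnKC// ltnW.
Qed.

Lemma esum_telescope (R : realType) (u : nat -> R) s :
  (forall n, u n.+1 <= u n) -> (u @ \oo --> (0 : R)) ->
  (\esum_(n in [set n | (s < n)%N]) (u n.-1 - u n)%:E = (u s)%:E)%E.
Proof.
move=> du u0.
transitivity (\esum_(i in [set: nat]) (u (s + i)%N - u (s + i).+1)%:E)%E.
  apply: (reindex_esum _ _ (fun i => (s + i).+1)); split => //.
  - by move=> i _ /=; rewrite ltnS leq_addr.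
  - by move=> i j _ _ [] /addnI.
  - move=> n /= sn; exists (n.-1 - s)%N => //.
    by rewrite subnKC ?prednK ?(leq_ltn_trans _ sn)// -ltnS prednK
      ?(leq_ltn_trans _ sn).
rewrite -nneseries_esumT; last by move=> n; rewrite lee_fin subr_ge0.
apply/cvg_lim => //.
have -> : (fun n => \sum_(0 <= i < n) (u (s + i)%N - u (s + i).+1)%:E)%E =
          (fun n => (u s - u (n + s)%N)%:E).
  apply/funext => n; rewrite sumEFin; congr EFin.
  elim: n => [|n IH]; first by rewrite big_geq// subrr.
  by rewrite big_nat_recr//= IH (addnC n) addrA subrK addSn addnC.
apply: cvg_EFin; first exact: nearW.
rewrite -[X in _ --> X](subr0 (u s)).
by apply: cvgB; [exact: cvg_cst|rewrite cvg_shiftn].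
Qed.

(** * Summing along strictly increasing chains *)

(** The backward step of a chain sum: a weight phi on the next point of the
    chain is carried back to the point s. *)
Definition transfer (R : realType) (K : nat -> nat -> nat -> R) (k : nat)
    (phi : nat -> \bar R) (s : nat) : \bar R :=
  (\esum_(N in [set N | (s < N)%N]) ((K k s N)%:E * phi N))%E.

Definition transfers (R : realType) (K : nat -> nat -> nat -> R)
    (ks : seq nat) (phi : nat -> \bar R) : nat -> \bar R :=
  foldr (transfer K) phi ks.

(** The adjoint forward step; a weight on the points of level i becomes a
    weight on those of level i + 1. *)
Definition push (R : realType) (K : nat -> nat -> nat -> R)
    (F : nat -> R) (k N : nat) : R := \sum_(s < N) F s * K k s N.

Definition pushes (R : realType) (K : nat -> nat -> nat -> R)
    (F : nat -> R) (ks : seq nat) : nat -> R := foldl (push K) F ks.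

Definition delta_zero (R : realType) (n : nat) : R := (n == 0)%:R.
Arguments delta_zero : clear implicits.

Lemma transfer_ge0 (R : realType) (K : nat -> nat -> nat -> R) k phi s :
  (forall k s N, 0 <= K k s N) -> (forall n, 0 <= phi n)%E ->
  (0 <= transfer K k phi s)%E.
Proof.
by move=> K0 phi0; apply: esum_ge0 => N _; rewrite mule_ge0 ?lee_fin.
Qed.

Lemma transfers_ge0 (R : realType) (K : nat -> nat -> nat -> R) ks phi s :
  (forall k s N, 0 <= K k s N) -> (forall n, 0 <= phi n)%E ->
  (0 <= transfers K ks phi s)%E.
Proof.
move=> K0 phi0; elim: ks s => [|k ks IH] s //=; exact: transfer_ge0.
Qed.

Lemma push_ge0 (R : realType) (K : nat -> nat -> nat -> R) F k N :
  (forall k s N, 0 <= K k s N) -> (forall n, 0 <= F n) -> 0 <= push K F k N.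
Proof. by move=> K0 F0; apply: sumr_ge0 => s _; rewrite mulr_ge0. Qed.

(** Moving one kernel across the pairing of F and phi is an exchange of two
    nonnegative sums over the pairs s < N. *)
Lemma transfers_adjoint (R : realType) (K : nat -> nat -> nat -> R) ks F phi :
  (forall k s N, 0 <= K k s N) -> (forall n, 0 <= F n) ->
  (forall n, 0 <= phi n)%E ->
  (\esum_(s in setT) ((F s)%:E * transfers K ks phi s) =
   \esum_(N in setT) ((pushes K F ks N)%:E * phi N))%E.
Proof.
move=> K0 + phi0; elim: ks F => [|k ks IH] F F0 //.
rewrite -[pushes _ _ _]/(pushes K (push K F k) ks).
rewrite -IH; last by move=> n; exact: push_ge0.
set psi := transfers K ks phi.
have psi0 n : (0 <= psi n)%E by exact: transfers_ge0.
have Kpsi0 s N : (0 <= (K k s N)%:E * psi N)%E by rewrite mule_ge0 ?lee_fin.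
have FKpsi0 s N : (0 <= (F s)%:E * ((K k s N)%:E * psi N))%E.
  by rewrite mule_ge0 ?lee_fin.
under eq_esum do rewrite -esumZl//.
transitivity (\esum_(s in setT)
    \esum_(N in [set N | [set: nat] N /\ (s < N)%N])
      ((F s)%:E * ((K k s N)%:E * psi N)))%E.
  by apply: eq_esum => s _; congr (esum _ _); apply/seteqP; split=> N /= // [].
rewrite (@esum_exchange _ _ _ _ _ (fun s N => (s < N)%N))//.
apply: eq_esum => N _.
transitivity (\esum_(s in [set s | (s < N)%N])
    ((F s)%:E * ((K k s N)%:E * psi N)))%E.
  by congr (esum _ _); apply/seteqP; split=> s /= // [].
rewrite esum_ord// -sumEFin ge0_sume_distrl; last first.
  by move=> s _; rewrite lee_fin mulr_ge0.
by apply: eq_bigr => s _; rewrite EFinM muleA.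
Qed.

(** Chains start at 0, so the pairing with the unit mass at 0 is what turns a
    chain sum into a single series. *)
Lemma transfers0 (R : realType) (K : nat -> nat -> nat -> R) ks phi :
  (forall k s N, 0 <= K k s N) -> (forall n, 0 <= phi n)%E ->
  (transfers K ks phi 0 =
   \esum_(N in setT) ((pushes K (delta_zero R) ks N)%:E * phi N))%E.
Proof.
move=> K0 phi0; rewrite -transfers_adjoint//.
rewrite (@esum_supp1 _ _ 0%N) /delta_zero ?eqxx ?mul1e//;
  first exact: transfers_ge0.
by move=> y /negPf ->; rewrite mul0e.
Qed.

Lemma le_transfer (R : realType) (K K' : nat -> nat -> nat -> R) k k'
    phi psi s :
  (forall N, (s < N)%N -> 0 <= K k s N <= K' k' s N) ->
  (forall N, (s < N)%N -> 0 <= phi N <= psi N)%E ->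
  (transfer K k phi s <= transfer K' k' psi s)%E.
Proof.
move=> HK Hphi; apply: le_esum => N /= sN.
have /andP[K0 KK] := HK _ sN; have /andP[p0 pp] := Hphi _ sN.
by rewrite lee_pmul ?lee_fin.
Qed.

Lemma eq_transfer (R : realType) (K : nat -> nat -> nat -> R) k phi psi s :
  (forall N, (s < N)%N -> phi N = psi N) ->
  transfer K k phi s = transfer K k psi s.
Proof. by move=> e; apply: eq_esum => N /= /e ->. Qed.

Lemma transfer_esum (R : realType) (K : nat -> nat -> nat -> R) k
    (T : choiceType) (B : set T) (x : T -> R) (phi : T -> nat -> \bar R) s :
  (forall k s N, 0 <= K k s N) -> (forall b, 0 <= x b) ->
  (forall b n, 0 <= phi b n)%E ->
  (transfer K k (fun n => \esum_(b in B) ((x b)%:E * phi b n)) s =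
   \esum_(b in B) ((x b)%:E * transfer K k (phi b) s))%E.
Proof.
move=> K0 x0 phi0; rewrite /transfer.
have xp0 b n : (0 <= (x b)%:E * phi b n)%E by rewrite mule_ge0 ?lee_fin.
have Kp0 b n : (0 <= (K k s n)%:E * phi b n)%E by rewrite mule_ge0 ?lee_fin.
transitivity (\esum_(N in [set N | (s < N)%N])
    \esum_(b in [set b | B b /\ True]) ((x b)%:E * ((K k s N)%:E * phi b N)))%E.
  apply: eq_esum => N _; rewrite -esumZl//.
  have -> : [set b | B b /\ True] = B by apply/seteqP; split=> b //= [].
  by apply: eq_esum => b _; rewrite muleCA.
rewrite (@esum_exchange _ _ _ _ _ (fun _ _ => True)); last first.
  by move=> i j _ _ _; rewrite mule_ge0 ?lee_fin.
apply: eq_esum => b _; rewrite -esumZl//; congr (esum _ _).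
by apply/seteqP; split=> N //= [].
Qed.

(** * Three chain kernels and the multiple sums they generate *)

Definition zeta_kernel (R : realType) (k s N : nat) : R := (N%:R ^+ k)^-1.
Arguments zeta_kernel : clear implicits.

(** The kernel of the series over n_1, ..., n_r alone: N is the new partial
    sum, and N - s the new summation index. *)
Definition gap_kernel (R : realType) (k s N : nat) : R :=
  ((N - s)%:R ^+ k)^-1 / N%:R.
Arguments gap_kernel : clear implicits.

(** The kernel of the series over the n_i and the m_i, where the index n_i < m_i
    has been summed out and N - s is m_i.  The term n = 0 vanishes when
    k > 0. *)
Definition cumulative_gap_kernel (R : realType) (k s N : nat) : R :=
  (\sum_(n < N - s) (n%:R ^+ k)^-1) / N%:R.
Arguments cumulative_gap_kernel : clear implicits.

Lemma zeta_kernel_ge0 (R : realType) k s N : 0 <= zeta_kernel R k s N.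
Proof. by rewrite invr_ge0 exprn_ge0. Qed.

Lemma gap_kernel_ge0 (R : realType) k s N : 0 <= gap_kernel R k s N.
Proof. by rewrite divr_ge0// invr_ge0 exprn_ge0. Qed.

Lemma cumulative_gap_kernel_ge0 (R : realType) k s N :
  0 <= cumulative_gap_kernel R k s N.
Proof.
by rewrite divr_ge0// sumr_ge0// => n _; rewrite invr_ge0 exprn_ge0.
Qed.

Lemma inv_powers_ge0 (R : realType) r (k n : r.-tuple nat) :
  0 <= inv_powers R k n.
Proof. by apply: prodr_ge0 => i _; rewrite invr_ge0 exprn_ge0. Qed.

Lemma inv_powers_cons (R : realType) r (k n : r.-tuple nat) (k0 n0 : nat) :
  inv_powers R [tuple of k0 :: k] [tuple of n0 :: n] =
  (n0%:R ^+ k0)^-1 * inv_powers R k n.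
Proof.
rewrite /inv_powers big_ord_recl; congr (_ * _).
by apply: eq_bigr => i _; rewrite !tnthS.
Qed.

(** The last point of the chain is left to a weight phi, so that a connector
    can be attached to it. *)
Lemma esum_increasing (R : realType) r (k : r.-tuple nat)
    (phi : nat -> \bar R) s :
  (forall n, 0 <= phi n)%E ->
  (\esum_(n in [set n : r.-tuple nat | path ltn s n])
     ((inv_powers R k n)%:E * phi (last s n)) =
   transfers (zeta_kernel R) k phi s)%E.
Proof.
move=> phi0; elim: r k s => [|r IH] k s.
  by rewrite (tuple0 k) esum_tuple0 /inv_powers ?big_ord0 ?mul1e.
case/tupleP: k => k0 k.
have ip0 t (n : r.-tuple nat) : (0 <= (inv_powers R k n)%:E * phi (last t n))%E.
  by rewrite mule_ge0// lee_fin inv_powers_ge0.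
rewrite (@esum_tuple_cons _ _ _ _ [set N | (s < N)%N]
  (fun N => [set n : r.-tuple nat | path ltn N n])); last 2 first.
- by move=> n; rewrite mule_ge0// lee_fin inv_powers_ge0.
- by move=> x n; split => /= [/andP[]|[? ?]] //; apply/andP.
rewrite -[RHS]/(transfer (zeta_kernel R) k0
  (transfers (zeta_kernel R) k phi) s).
apply: eq_esum => N _; rewrite -IH -esumZl ?zeta_kernel_ge0//.
by apply: eq_esum => n _; rewrite inv_powers_cons EFinM muleA.
Qed.

Lemma partial_sum_cons0 r (t : r.-tuple nat) (x : nat) :
  partial_sum [tuple of x :: t] 0 = x.
Proof.
by rewrite /partial_sum big_mkcond big_ord_recl/= big1 ?addn0.
Qed.

Lemma partial_sum_consS r (t : r.-tuple nat) (x j : nat) :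
  partial_sum [tuple of x :: t] j.+1 = (x + partial_sum t j)%N.
Proof.
rewrite /partial_sum big_mkcond big_ord_recl/=; congr addn.
by rewrite [RHS]big_mkcond; apply: eq_bigr => i _; rewrite tnthS.
Qed.

Lemma prod_partial_sum_cons (R : realType) r (t : r.-tuple nat) (x s : nat) :
  \prod_(j < r.+1) (s + partial_sum [tuple of x :: t] j)%N%:R =
  (s + x)%N%:R * \prod_(j < r) (s + x + partial_sum t j)%N%:R :> R.
Proof.
rewrite big_ord_recl partial_sum_cons0; congr (_ * _).
by apply: eq_bigr => i _; rewrite [lift _ _ : nat]/= partial_sum_consS addnA.
Qed.

Lemma sum_tuple_cons r (t : r.-tuple nat) (x : nat) :
  (\sum_(i < r.+1) tnth [tuple of x :: t] i = x + \sum_(i < r) tnth t i)%N.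
Proof.
by rewrite big_ord_recl; congr addn; apply: eq_bigr => i _; rewrite tnthS.
Qed.

Lemma forall_tnth_cons (T : Type) r (t : r.-tuple T) (x : T) (P : T -> Prop) :
  (forall i, P (tnth [tuple of x :: t] i)) <->
  P x /\ (forall i, P (tnth t i)).
Proof.
split=> [H|[Px H] i].
  by split=> [|i]; [exact: (H ord0)|rewrite -(tnthS x)].
by case: (unliftP ord0 i) => [j|] -> //; rewrite tnthS.
Qed.

(** A tuple of positive indices is the same as the chain of its partial sums;
    the offset s makes an induction on the first index possible. *)
Lemma esum_gaps (R : realType) r (k : r.-tuple nat) (phi : nat -> \bar R) s :
  (forall n, 0 <= phi n)%E ->
  (\esum_(n in [set n : r.-tuple nat | forall i, (1 <= tnth n i)%N])
     ((inv_powers R k n * (\prod_(j < r) (s + partial_sum n j)%N%:R)^-1)%:E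
      * phi (s + \sum_(i < r) tnth n i)%N) =
   transfers (gap_kernel R) k phi s)%E.
Proof.
move=> phi0; elim: r k s => [|r IH] k s.
  rewrite (tuple0 k) esum_tuple0 /inv_powers ?big_ord0 ?invr1 ?mul1r ?mul1e
    ?addn0//.
  by case.
case/tupleP: k => k0 k.
have ip0 r' t (k' n : r'.-tuple nat) : (0 <= (inv_powers R k' n *
    (\prod_(j < r') (t + partial_sum n j)%N%:R)^-1)%:E *
    phi (t + \sum_(i < r') tnth n i)%N)%E.
  rewrite mule_ge0// lee_fin mulr_ge0 ?inv_powers_ge0// invr_ge0.
  by rewrite prodr_ge0.
rewrite (@esum_tuple_cons _ _ _ _ [set N | (0 < N)%N]
  (fun N => [set n : r.-tuple nat | forall i, (1 <= tnth n i)%N]));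
  last 2 first.
- by move=> n; exact: ip0.
- by move=> x n /=; exact: (forall_tnth_cons n x (fun y => (1 <= y)%N)).
rewrite -[RHS]/(transfer (gap_kernel R) k0 (transfers (gap_kernel R) k phi) s).
rewrite /transfer [RHS]esum_gt_shift; apply: eq_esum => N /= N0.
rewrite -IH -esumZl ?gap_kernel_ge0//.
apply: eq_esum => n _; rewrite inv_powers_cons prod_partial_sum_cons.
rewrite sum_tuple_cons addnA muleA -EFinM /gap_kernel addKn invfM.
by congr (_%:E * _)%E; rewrite !mulrA; congr (_ * _); rewrite mulrAC.
Qed.

Lemma transfer_cumulative_gap (R : realType) k (phi : nat -> \bar R) s :
  (1 <= k)%N -> (forall n, 0 <= phi n)%E ->
  (\esum_(x in [set x : nat * nat | (1 <= x.1)%N /\ (x.1 < x.2)%N])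
     (((x.1%:R ^+ k)^-1 / (s + x.2)%N%:R)%:E * phi (s + x.2)%N) =
   transfer (cumulative_gap_kernel R) k phi s)%E.
Proof.
move=> k1 phi0; rewrite /transfer [RHS]esum_gt_shift.
pose a m n : \bar R := (((n%:R ^+ k)^-1 / (s + m)%N%:R)%:E * phi (s + m)%N)%E.
have a0 m n : (0 <= a m n)%E.
  by rewrite mule_ge0// lee_fin divr_ge0// invr_ge0 exprn_ge0.
transitivity (\esum_(m in [set m | (0 < m)%N])
    \esum_(n in [set n | (1 <= n)%N /\ (n < m)%N]) a m n)%E.
  rewrite esum_esum//; apply: (reindex_esum _ _ (fun x => (x.2, x.1))); split.
  - by move=> [m n] /= [_ []].
  - by move=> [m n] [m' n'] _ _ [-> ->].
  - move=> [n m] /= [n1 nm]; exists (m, n) => //=; split => //.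
    exact: leq_ltn_trans nm.
apply: eq_esum => m _.
transitivity (\esum_(n in [set n | (n < m)%N]) a m n)%E.
  rewrite esum_mkcond [RHS]esum_mkcond; apply: eq_esum => -[|n] _; last first.
    by congr (if _ then _ else _); apply/idP/idP; rewrite !inE/= => // -[].
  have -> : a m 0%N = 0%E by rewrite /a expr0n gtn_eqF// invr0 mul0r mul0e.
  by do 2 case: ifP.
rewrite esum_ord// /cumulative_gap_kernel addKn mulr_suml -sumEFin.
by rewrite ge0_sume_distrl// => n _;
  rewrite lee_fin divr_ge0// invr_ge0 exprn_ge0.
Qed.

Lemma esum_cumulative_gaps (R : realType) r (k : r.-tuple nat)
    (phi : nat -> \bar R) s :
  (forall i, (1 <= tnth k i)%N) -> (forall n, 0 <= phi n)%E ->
  (\esum_(nm in [set nm : r.-tuple nat * r.-tuple nat |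
       forall i, (1 <= tnth nm.1 i)%N /\ (tnth nm.1 i < tnth nm.2 i)%N])
     ((inv_powers R k nm.1 *
       (\prod_(j < r) (s + partial_sum nm.2 j)%N%:R)^-1)%:E
      * phi (s + \sum_(i < r) tnth nm.2 i)%N) =
   transfers (cumulative_gap_kernel R) k phi s)%E.
Proof.
move=> + phi0; elim: r k s => [|r IH] k s k1.
  rewrite (tuple0 k) -[RHS]mul1e -[s in RHS]addn0.
  rewrite (_ : [set _ | _] = [set ([tuple], [tuple])]); last first.
    by apply/seteqP; split=> -[n m] /=; rewrite (tuple0 n) (tuple0 m)// => _ [].
  rewrite esum_set1; last first.
    by rewrite mule_ge0// lee_fin mulr_ge0 ?inv_powers_ge0 ?invr_ge0 ?prodr_ge0.
  by rewrite /inv_powers !big_ord0 invr1 mul1r.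
case/tupleP: k k1 => k0 k.
move=> /(forall_tnth_cons k k0 (fun y => (1 <= y)%N))[k01 k1].
have ip0 r' t (k' n m : r'.-tuple nat) : (0 <= (inv_powers R k' n *
    (\prod_(j < r') (t + partial_sum m j)%N%:R)^-1)%:E *
    phi (t + \sum_(i < r') tnth m i)%N)%E.
  rewrite mule_ge0// lee_fin mulr_ge0 ?inv_powers_ge0// invr_ge0.
  by rewrite prodr_ge0.
rewrite (@esum_tuple_cons2 _ _ _ _ _
  [set x : nat * nat | (1 <= x.1)%N /\ (x.1 < x.2)%N]
  [set nm : r.-tuple nat * r.-tuple nat |
     forall i, (1 <= tnth nm.1 i)%N /\ (tnth nm.1 i < tnth nm.2 i)%N]);
  last 2 first.
- by move=> n; exact: ip0.
- move=> x y n m /=; split=> [H|[Hxy H] i].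
    by split=> [|i]; [exact: (H ord0)|have := H (lift ord0 i); rewrite !tnthS].
  by case: (unliftP ord0 i) => [j|] -> //; rewrite !tnthS.
rewrite -[RHS]/(transfer (cumulative_gap_kernel R) k0
  (transfers (cumulative_gap_kernel R) k phi) s).
rewrite -transfer_cumulative_gap//; last first.
  by move=> n; exact: transfers_ge0 (@cumulative_gap_kernel_ge0 R) _.
apply: eq_esum => -[n0 m0] /= _.
rewrite -IH// -esumZl ?divr_ge0 ?invr_ge0 ?exprn_ge0//.
apply: eq_esum => -[n m] _ /=; rewrite inv_powers_cons prod_partial_sum_cons.
rewrite sum_tuple_cons addnA muleA -EFinM invfM.
by congr (_%:E * _)%E; rewrite !mulrA; congr (_ * _); rewrite mulrAC.
Qed.

(** * The Seki-Yamamoto connector *)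

(** This is a! b! / (a + b)!, in the form where its bounds are those of a
    binomial coefficient. *)
Definition connector (R : realType) (a b : nat) : R := ('C(a + b, a)%:R)^-1.
Arguments connector : clear implicits.

Lemma connector_ge0 (R : realType) a b : 0 <= connector R a b.
Proof. by rewrite invr_ge0. Qed.

Lemma connectorC (R : realType) a b : connector R a b = connector R b a.
Proof.
by rewrite /connector addnC -[in RHS](bin_sub (leq_addr a b)) addKn.
Qed.

Lemma connector0 (R : realType) b : connector R 0 b = 1.
Proof. by rewrite /connector bin0 invr1. Qed.

Lemma connector_le (R : realType) a b : (0 < b)%N ->
  connector R a b <= a.+1%:R^-1.
Proof.
move=> b0; rewrite lef_pV2 ?posrE ?ltr0n ?bin_gt0 ?leq_addr// ler_nat.
by rewrite -[leqLHS](binSn a) leq_bin2l// -addn1 leq_add2l.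
Qed.

(** The identity that makes [transport] telescope; it amounts to
    C(c, b) = C(c + 1, b) (c + 1 + b) / (c + 1). *)
Lemma connector_diff (R : realType) c b :
  c.+1%:R^-1 * connector R c.+1 b.+1 =
  b.+1%:R^-1 * (connector R c b.+1 - connector R c.+1 b.+1) :> R.
Proof.
rewrite /connector.
have nz n : n.+1%:R != 0 :> R by rewrite pnatr_eq0.
have Cnz n m : 'C(n + m, n)%:R != 0 :> R.
  by rewrite pnatr_eq0 -lt0n bin_gt0 leq_addr.
have /(congr1 (fun n => n%:R : R)) := mul_bin_diag (c.+1 + b.+1) c.
rewrite addSn/= -addSn !natrM natrD => E.
have -> : 'C(c + b.+1, c)%:R =
   (c.+1%:R * 'C(c.+1 + b.+1, c.+1)%:R) / (c.+1%:R + b.+1%:R) :> R.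
  rewrite -E mulrAC divff ?mul1r// -natrD addSn; exact: nz.
have s0 : c.+1%:R + b.+1%:R != 0 :> R by rewrite -natrD addSn; exact: nz.
by field; rewrite !nat1r Cnz s0 !nz.
Qed.

(** By [connector_diff] the terms are the differences of C(c, b) / b, and
    C(c, b) tends to 0 because b is positive. *)
Lemma transport (R : realType) a b : (0 < b)%N ->
  (\esum_(c in [set c | (a < c)%N]) (c%:R^-1 * connector R c b)%:E =
   (b%:R^-1 * connector R a b)%:E)%E.
Proof.
case: b => // b _.
have d0 n : connector R n.+1 b.+1 <= connector R n b.+1.
  rewrite -subr_ge0 -(@pmulr_rge0 _ (b.+1%:R^-1)) ?invr_gt0// -connector_diff.
  by rewrite mulr_ge0// connector_ge0.
rewrite EFinM -(@esum_telescope _ (fun n => connector R n b.+1))//; last first.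
  apply: squeeze_cvgr (cvg_cst 0) (@cvg_harmonic R).
  by apply: nearW => n; rewrite connector_ge0/= connector_le.
rewrite -esumZl ?invr_ge0//; last first.
  by move=> -[|n]; rewrite lee_fin ?subrr ?subr_ge0.
by apply: eq_esum => -[|c] //= _; rewrite connector_diff EFinM.
Qed.

Lemma fact_ratioE (R : realType) a b : (0 < a)%N ->
  fact_ratio R a b = a%:R^-1 * connector R a b.
Proof.
case: a => // a _.
have pE : (\prod_(0 <= i < b.+1) (a.+1 + i) * a`! = (a.+1 + b)`!)%N.
  elim: b => [|b IH]; first by rewrite big_nat1 addn0 factS.
  by rewrite big_nat_recr//= mulnAC IH mulnC addnS factS.
have nz n : n`!%:R != 0 :> R by rewrite pnatr_eq0 -lt0n fact_gt0.
have := congr1 (fun n => n%:R : R) (bin_fact (leq_addr b a.+1)).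
rewrite /fact_ratio /connector addKn -pE -!natr_prod factS !natrM => E.
set p := (X in _ / X); set c := _%:R^-1 * _.
have p0 : p != 0.
  have := nz (a.+1 + b)%N; rewrite -pE natrM; apply: contraNneq.
  by rewrite /p => ->; rewrite mul0r.
move: E; rewrite -/p => E.
have C0 : 'C(a.+1 + b, a.+1)%:R != 0 :> R.
  by rewrite pnatr_eq0 -lt0n bin_gt0 leq_addr.
apply: (mulIf p0); rewrite mulfVK//.
apply: (mulIf (nz a)); rewrite -mulrA -E /c.
by field; rewrite nat1r C0 pnatr_eq0.
Qed.

Lemma transfers_connector (R : realType) j a b : (0 < b)%N ->
  (transfers (zeta_kernel R) (nseq j 1%N) (fun c => (connector R c b)%:E) a =
   ((b%:R ^+ j)^-1 * connector R a b)%:E)%E.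
Proof.
move=> b0; elim: j a => [|j IH] a; first by rewrite expr0 invr1 mul1r.
rewrite -[LHS]/(transfer _ 1 (transfers _ (nseq j 1%N) _) _).
transitivity (\esum_(c in [set c | (a < c)%N])
   ((b%:R ^+ j)^-1%:E * (c%:R^-1 * connector R c b)%:E))%E.
  by apply: eq_esum => c _; rewrite IH /zeta_kernel expr1 -!EFinM mulrCA.
rewrite esumZl ?invr_ge0 ?exprn_ge0// ?transport//.
  by rewrite -EFinM mulrA exprSr invfM mulrC.
by move=> i; rewrite lee_fin mulr_ge0// connector_ge0.
Qed.

(** The sum of 1 / c^2 over c > a becomes, after opening one factor 1 / c into
    the sum of C(c, b) / b over b > 0, a sum over b in which [transport]
    applies to each further factor 1 / c. *)
Lemma transfers_ones_two (R : realType) j a :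
  (transfers (zeta_kernel R) (rcons (nseq j 1%N) 2%N) (fun=> 1) a =
   \esum_(b in [set b | (0 < b)%N])
     ((b%:R ^+ (j + 2))^-1 * connector R a b)%:E)%E.
Proof.
elim: j a => [|j IH] a.
  rewrite -[LHS]/(transfer _ 2 _ a).
  (* 1 / c^2 = 1 / c * (C(0, c) / c), and transport rewrites C(0, c) / c. *)
  transitivity (transfer (zeta_kernel R) 1
    (fun c => \esum_(b in [set b | (0 < b)%N])
      ((b%:R^-1)%:E * (connector R c b)%:E))%E a)%E.
    apply: eq_esum => c /= ac.
    have c0 : (0 < c)%N by exact: leq_ltn_trans ac.
    under eq_esum => b _ do rewrite connectorC -EFinM.
    rewrite transport// connector0 /zeta_kernel expr1 -!EFinM !mulr1.
    by rewrite expr2 invfM.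
  rewrite transfer_esum//.
  - apply: eq_esum => b /= b0.
    have := @transfers_connector R 1 a b b0; rewrite /transfers/= => ->.
    by rewrite -EFinM mulrA expr1 add0n expr2 invfM.
  - exact: zeta_kernel_ge0.
  - by move=> b n; rewrite lee_fin connector_ge0.
rewrite -[LHS]/(transfer _ 1 (transfers _ (rcons (nseq j 1%N) 2%N) _) a).
rewrite (@eq_transfer _ _ _ _ (fun c => \esum_(b in [set b | (0 < b)%N])
   ((b%:R ^+ (j + 2))^-1%:E * (connector R c b)%:E))%E);
  last by move=> c _; exact: IH.
rewrite transfer_esum//.
- apply: eq_esum => b /= b0.
  have := @transfers_connector R 1 a b b0; rewrite /transfers/= => ->.
  by rewrite -EFinM mulrA expr1 addSn exprSr invfM mulrC mulrA.
- exact: zeta_kernel_ge0.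
- by move=> b n; rewrite lee_fin connector_ge0.
Qed.

(** * Convergence of multiple zeta values *)

(** The terms are at most 2 / (b (b + 1)) = 2 C(b, 1) / b, which [transport]
    sums to 2. *)
Lemma esum_inv_square_lty (R : realType) :
  (\esum_(b in [set b | (0 < b)%N]) (b%:R ^- 2)%:E < (+oo : \bar R))%E.
Proof.
apply: (@le_lt_trans _ _ (2%:E * \esum_(b in [set b | (0 < b)%N])
    (b%:R^-1 * connector R b 1)%:E)%E); last by rewrite transport// -EFinM ltry.
rewrite -esumZl//; last first.
  by move=> b; rewrite lee_fin mulr_ge0// connector_ge0.
apply: le_esum => -[|b] //= _; rewrite -EFinM lee_fin.
rewrite /connector addn1 binSn expr2 invfM mulrCA ler_wpM2l//.
rewrite -(@ler_pM2r _ b.+2%:R) ?ltr0n// mulfVK ?pnatr_eq0//.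
rewrite mulrC ler_pdivrMr ?ltr0n//.
by rewrite -natrM ler_nat mul2n -addnn addSn ltnS leq_addl.
Qed.

(** Lowering the exponents to 1, ..., 1, 2 increases the terms, and
    [transfers_ones_two] at a = 0 evaluates the resulting sum. *)
Lemma transfers_admissible_lty (R : realType) ks k :
  all (leq 1) ks -> (2 <= k)%N ->
  (transfers (zeta_kernel R) (rcons ks k) (fun=> 1) 0 < +oo)%E.
Proof.
move=> ks1 k2.
have zk s i j N : (i <= j)%N -> (s < N)%N ->
    0 <= zeta_kernel R j s N <= zeta_kernel R i s N.
  move=> ij sN; rewrite zeta_kernel_ge0/= lef_pV2 ?posrE ?exprn_gt0 ?ltr0n
    ?(leq_ltn_trans _ sN)//.
  by rewrite ler_weXn2l// ler1n (leq_ltn_trans _ sN).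
apply: (@le_lt_trans _ _
    (transfers (zeta_kernel R) (rcons (nseq (size ks) 1%N) 2%N) (fun=> 1) 0)%E).
  suff : forall s, (transfers (zeta_kernel R) (rcons ks k) (fun=> 1) s <=
    transfers (zeta_kernel R) (rcons (nseq (size ks) 1%N) 2%N) (fun=> 1) s)%E
    by [].
  elim: ks ks1 => [_|i ks IH /= /andP[i1 ks1]] s.
    apply: le_transfer => N sN; first exact: zk.
    by rewrite lee01 lexx.
  apply: le_transfer => N sN; first exact: zk.
  by rewrite transfers_ge0 ?IH//; exact: zeta_kernel_ge0.
rewrite transfers_ones_two; apply: le_lt_trans (esum_inv_square_lty R).
apply: le_esum => -[|b] //= _; rewrite connector0 mulr1 lee_fin.
by rewrite lef_pV2 ?posrE ?exprn_gt0// ler_weXn2l ?ler1n// leq_addl.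
Qed.

Lemma mzv_transfers (R : realType) r (k : r.-tuple nat) : admissible k ->
  (mzv R k)%:E = transfers (zeta_kernel R) k (fun=> 1%E) 0.
Proof.
move=> [r1 k1 klast].
have E : (\esum_(n in increasing_indices r) (inv_powers R k n)%:E =
    transfers (zeta_kernel R) k (fun=> 1) 0)%E.
  by rewrite -esum_increasing//; apply: eq_esum => n _; rewrite mule1.
rewrite /mzv E fineK// ge0_fin_numE; last first.
  by apply: transfers_ge0 => //; exact: zeta_kernel_ge0.
have : all (leq 1) k by apply/all_tnthP.
case/lastP: (tval k) klast => // ks i; rewrite last_rcons all_rcons => i2.
by move=> /andP[_ ks1]; exact: transfers_admissible_lty.
Qed.

(** * Coefficient sequences of polylogarithms *)

(** On generating functions f(x), this is the primitive of f(x) / x. The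
    coefficient of index 0 is sent to 0. *)
Definition div_index (R : realType) (f : nat -> R) (n : nat) : R := f n / n%:R.

(** On generating functions, the multiplication by x / (1 - x). *)
Definition psum (R : realType) (f : nat -> R) (n : nat) : R := \sum_(i < n) f i.

Definition conv (R : realType) (f g : nat -> R) (n : nat) : R :=
  \sum_(i < n.+1) f i * g (n - i)%N.

Definition addf (R : realType) (f g : nat -> R) (n : nat) : R := f n + g n.

Lemma convC (R : realType) (f g : nat -> R) : conv f g = conv g f.
Proof.
apply/funext => n; rewrite /conv (reindex_inj rev_ord_inj)/=.
apply: eq_bigr => i _; rewrite subSS mulrC subKn// -ltnS; exact: ltn_ord.
Qed.

Lemma conv_addr (R : realType) (f g h : nat -> R) :
  conv f (addf g h) = addf (conv f g) (conv f h).
Proof.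
apply/funext => n; rewrite /addf /conv -big_split/=.
by apply: eq_bigr => i _; rewrite mulrDr.
Qed.

Lemma conv_delta_zero (R : realType) (g : nat -> R) : conv (delta_zero R) g = g.
Proof.
apply/funext => n; rewrite /conv big_ord_recl subn0 mul1r big1 ?addr0//.
by move=> i _; rewrite /delta_zero mul0r.
Qed.

(** Both sides gain the n-th convolution coefficient when n increases by 1. *)
Lemma conv_psum (R : realType) (f g : nat -> R) :
  conv (psum f) g = psum (conv f g).
Proof.
apply/funext; elim=> [|n IH].
  by rewrite /conv /psum big_ord1 !big_ord0 mul0r.
rewrite [RHS]/psum big_ord_recr/= -[X in _ = X + _]/(psum (conv f g) n) -IH.
rewrite /conv big_ord_recl {1}/psum big_ord0 mul0r add0r -big_split/=.
apply: eq_bigr => i _; rewrite -mulrDl subSS; congr (_ * _).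
by rewrite /psum big_ord_recr.
Qed.

(** Integration by parts for the generating functions, or, on coefficients,
    the identity 1 / (i j) = (1 / i + 1 / j) / (i + j). The hypotheses at 0
    are needed because 1 / 0 = 0 breaks that identity when i or j is 0. *)
Lemma conv_div_index (R : realType) (f g : nat -> R) : f 0%N = 0 -> g 0%N = 0 ->
  conv (div_index f) (div_index g) =
  div_index (addf (conv f (div_index g)) (conv g (div_index f))).
Proof.
move=> f0 g0; apply/funext => n; rewrite [conv g _]convC.
rewrite /div_index /addf /conv -big_split/= mulr_suml; apply: eq_bigr => i _.
have [->|i0] := eqVneq (i : nat) 0%N; first by rewrite f0 !mul0r addr0 mul0r.
have [->|i_n] := eqVneq (i : nat) n.
  by rewrite subnn g0 !(mul0r,mulr0) addr0 mul0r.
have ltin : (i < n)%N by rewrite ltn_neqAle i_n -ltnS ltn_ord.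
have nE : n%:R = i%:R + (n - i)%N%:R :> R by rewrite -natrD subnKC// ltnW.
have iR : i%:R != 0 :> R by rewrite pnatr_eq0.
have niR : (n - i)%N%:R != 0 :> R by rewrite pnatr_eq0 subn_eq0 -ltnNge.
have nR : i%:R + (n - i)%N%:R != 0 :> R.
  by rewrite -nE pnatr_eq0 -lt0n (leq_ltn_trans _ ltin).
by rewrite nE; field; rewrite iR niR nR.
Qed.

(** Sums of coefficient sequences of multiple polylogarithms, presented as
    iterated integrals with respect to dx / x and dx / (1 - x). Sums suffice,
    without rational coefficients, since a shuffle product has no signs. *)
Inductive polylog_coef (R : realType) : (nat -> R) -> Prop :=
| polylog_coef_log : polylog_coef (div_index (psum (delta_zero R)))
| polylog_coef_div f : polylog_coef f -> polylog_coef (div_index f)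
| polylog_coef_psum f : polylog_coef f -> polylog_coef (div_index (psum f))
| polylog_coef_add f g :
    polylog_coef f -> polylog_coef g -> polylog_coef (addf f g).

Lemma polylog_coef_at0 (R : realType) (f : nat -> R) : polylog_coef f ->
  f 0%N = 0.
Proof.
by elim=> {f} [|f _ _|f _ _|f g _ f0 _ g0];
  rewrite /div_index /addf ?invr0 ?mulr0 ?f0 ?g0 ?addr0.
Qed.

Lemma div_index_add (R : realType) (f g : nat -> R) :
  div_index (addf f g) = addf (div_index f) (div_index g).
Proof. by apply/funext => n; rewrite /div_index /addf mulrDl. Qed.

Lemma psum_add (R : realType) (f g : nat -> R) :
  psum (addf f g) = addf (psum f) (psum g).
Proof. by apply/funext => n; rewrite /psum /addf big_split. Qed.

Lemma psum0 (R : realType) (f : nat -> R) : psum f 0%N = 0.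
Proof. by rewrite /psum big_ord0. Qed.

(** The inner induction of the shuffle product: the first factor is the
    primitive of a(x) / x, and convolution with a itself is already under
    control. *)
Lemma polylog_coef_conv_div (R : realType) (a g : nat -> R) : a 0%N = 0 ->
  polylog_coef (div_index a) ->
  (forall h, polylog_coef h -> polylog_coef (div_index (conv a h))) ->
  polylog_coef g -> polylog_coef (conv (div_index a) g).
Proof.
move=> a0 Pa Ha.
have step b : b 0%N = 0 -> polylog_coef (div_index b) ->
    polylog_coef (div_index (conv b (div_index a))) ->
    polylog_coef (conv (div_index a) (div_index b)).
  move=> b0 Pb Hb; rewrite conv_div_index// div_index_add.
  by apply: polylog_coef_add => //; exact: Ha.
elim=> {g} [|g Pg IH|g Pg IH|g1 g2 _ IH1 _ IH2].
- apply: step; [exact: psum0|exact: polylog_coef_log|].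
  by rewrite conv_psum conv_delta_zero; exact: polylog_coef_psum.
- apply: step; [exact: polylog_coef_at0|exact: polylog_coef_div|].
  by rewrite convC; exact: polylog_coef_div.
- apply: step; [exact: psum0|exact: polylog_coef_psum|].
  by rewrite conv_psum convC; exact: polylog_coef_psum.
- by rewrite conv_addr; exact: polylog_coef_add.
Qed.

(** Shuffle product of multiple polylogarithms: [conv_div_index] writes the
    product of two iterated integrals as an integral of products in which one
    factor has lost its outermost integration, so an induction on both factors
    applies. *)
Lemma polylog_coef_conv (R : realType) (f g : nat -> R) :
  polylog_coef f -> polylog_coef g -> polylog_coef (conv f g).
Proof.
move=> Pf; elim: Pf g => {f} [|f Pf IH|f Pf IH|f1 f2 _ IH1 _ IH2] g Pg.
- apply: polylog_coef_conv_div Pg; [exact: psum0|exact: polylog_coef_log|].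
  by move=> h Ph; rewrite conv_psum conv_delta_zero; exact: polylog_coef_psum.
- apply: polylog_coef_conv_div Pg;
  [exact: polylog_coef_at0|exact: polylog_coef_div|].
  by move=> h Ph; apply: polylog_coef_div; exact: IH.
- apply: polylog_coef_conv_div Pg; [exact: psum0|exact: polylog_coef_psum|].
  by move=> h Ph; rewrite conv_psum; apply: polylog_coef_psum; exact: IH.
- rewrite convC conv_addr ![conv g _]convC.
  by apply: polylog_coef_add; [exact: IH1|exact: IH2].
Qed.

Lemma pushes_rcons (R : realType) (K : nat -> nat -> nat -> R) F ks k :
  pushes K F (rcons ks k) = push K (pushes K F ks) k.
Proof. by rewrite /pushes foldl_rcons. Qed.

Lemma push_zeta1 (R : realType) (F : nat -> R) :
  push (zeta_kernel R) F 1 = div_index (psum F).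
Proof. by apply/funext => N; rewrite /push -mulr_suml. Qed.

Lemma push_zetaS (R : realType) (F : nat -> R) k :
  push (zeta_kernel R) F k.+1 = div_index (push (zeta_kernel R) F k).
Proof.
apply/funext => N; rewrite /div_index /push /zeta_kernel -!mulr_suml.
by rewrite exprSr invfM mulrA.
Qed.

Definition positive_word (w : seq nat) := (w != [::]) && all (leq 1) w.

(** Dividing by N raises the last exponent of a word, and dividing the partial
    sums by N appends an exponent 1. *)
Lemma polylog_coef_words (R : realType) (f : nat -> R) : polylog_coef f ->
  exists2 L : seq (seq nat), all positive_word L &
    f = fun n => \sum_(w <- L) pushes (zeta_kernel R) (delta_zero R) w n.
Proof.
pose S w := pushes (zeta_kernel R) (delta_zero R) w.
have divS w : positive_word w ->
  exists2 w', positive_word w' & div_index (S w) = S w'.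
  case/lastP: w => // w k /andP[_]; rewrite all_rcons => /andP[k1 w1].
  exists (rcons w k.+1).
    by rewrite /positive_word -size_eq0 size_rcons all_rcons.
  by rewrite /S !pushes_rcons push_zetaS.
have psumS w : positive_word w ->
  exists2 w', positive_word w' & div_index (psum (S w)) = S w'.
  move=> /andP[_ w1]; exists (rcons w 1%N).
    by rewrite /positive_word -size_eq0 size_rcons all_rcons.
  by rewrite /S pushes_rcons push_zeta1.
have mapL (op : (nat -> R) -> nat -> R) L :
    (forall g h, op (addf g h) = addf (op g) (op h)) ->
    (op (fun=> 0) = fun=> 0) ->
    (forall w, positive_word w ->
      exists2 w', positive_word w' & op (S w) = S w') ->
    all positive_word L -> exists2 L', all positive_word L' &
      op (fun n => \sum_(w <- L) S w n) = fun n => \sum_(w <- L') S w n.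
  move=> opD op0 opS; elim: L => [_|w L IH /= /andP[w1 /IH[L' L'1 e]]].
    exists [::] => //; rewrite -[RHS](_ : (fun=> 0) = _).
      by rewrite -[RHS]op0; congr op; apply/funext => n; rewrite big_nil.
    by apply/funext => n; rewrite big_nil.
  have [w' w'1 e'] := opS _ w1; exists (w' :: L') => /=; first by rewrite w'1.
  transitivity (addf (S w') (fun n => \sum_(w <- L') S w n)).
    by rewrite -e -e' -opD; congr op; apply/funext => n; rewrite big_cons.
  by apply/funext => n; rewrite big_cons.
have d0 : div_index (fun=> 0 : R) = (fun=> 0).
  by apply/funext => n; rewrite /div_index mul0r.
elim=> {f} [|f Pf [L L1 ->]|f Pf [L L1 ->]|f g Pf [L L1 ->] Pg [L' L'1 ->]].
- exists [:: [:: 1%N]] => //.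
  by rewrite -push_zeta1; apply/funext => n; rewrite big_seq1.
- by apply: mapL => //; exact: div_index_add.
- apply: (mapL (fun f => div_index (psum f))) => //.
  + by move=> g h; rewrite psum_add div_index_add.
  + by rewrite -[RHS]d0; congr div_index; apply/funext => n; rewrite /psum big1.
- exists (L ++ L'); first by rewrite all_cat L1.
  by apply/funext => n; rewrite big_cat.
Qed.

Lemma Qsubalgebra_mzv_algebra (R : realType) : Qsubalgebra (mzv_algebra R).
Proof.
split=> [A [[]//]|x y Ax Ay A AA|x y Ax Ay A AA|q x Ax A AA].
- by case: (AA) => -[_ H _ _] _; apply: H; [exact: Ax|exact: Ay].
- by case: (AA) => -[_ _ H _] _; apply: H; [exact: Ax|exact: Ay].
- by case: (AA) => -[_ _ _ H] _; apply: H; exact: Ax.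
Qed.

Lemma mzv_in_algebra (R : realType) r (k : r.-tuple nat) : admissible k ->
  mzv_algebra R (mzv R k).
Proof. by move=> ak A [_]; apply; exists r, k. Qed.

(** Dividing by N makes the last exponent of each word at least 2, hence the
    word admissible. *)
Lemma esum_polylog_coef (R : realType) (f : nat -> R) : polylog_coef f ->
  exists2 x : R, mzv_algebra R x &
    (\esum_(N in setT) (div_index f N)%:E = x%:E)%E.
Proof.
move=> /polylog_coef_words[L L1 ->].
pose S w := pushes (zeta_kernel R) (delta_zero R) w.
have -> : div_index (fun n => \sum_(w <- L) S w n) =
    fun n => \sum_(w <- L) div_index (S w) n.
  by apply/funext => n; rewrite /div_index mulr_suml.
have S0 w n : 0 <= div_index (S w) n.
  rewrite divr_ge0// /S; elim/last_ind: w n => [|w k IH] n; first exact: ler0n.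
  by rewrite pushes_rcons; apply: push_ge0 => //; exact: zeta_kernel_ge0.
under eq_esum do rewrite -sumEFin.
rewrite esum_sum; last by move=> *; rewrite lee_fin.
have [_ addA _ ratA] := Qsubalgebra_mzv_algebra R.
elim: L L1 => [_|w L IH /= /andP[w1 /IH[x Ax e]]].
  exists 0; last by rewrite big_nil.
  have [A1 _ _ _] := Qsubalgebra_mzv_algebra R.
  by rewrite -(mul0r 1) -(raddf0 (ratr : rat -> R)); exact: ratA.
case/lastP: w w1 => // w k /andP[_]; rewrite all_rcons => /andP[k1 w1].
have ak : admissible (in_tuple (rcons w k.+1)).
  split; first by rewrite size_rcons.
    by apply/all_tnthP; rewrite /= all_rcons w1.
  by rewrite /= last_rcons.
exists (mzv R (in_tuple (rcons w k.+1)) + x).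
  by apply: addA => //; exact: mzv_in_algebra.
rewrite big_cons e EFinD; congr (_ + _)%E.
rewrite mzv_transfers// transfers0//; last exact: zeta_kernel_ge0.
by apply: eq_esum => N _; rewrite mule1/= /S !pushes_rcons push_zetaS.
Qed.

(** * The two series as sums of polylogarithm coefficients *)

Lemma polylog_coef_power (R : realType) k : (1 <= k)%N ->
  polylog_coef (fun N => (N%:R ^+ k)^-1 : R).
Proof.
case: k => // k _; elim: k => [|k IH].
  have -> : (fun N => (N%:R ^+ 1)^-1) = div_index (psum (delta_zero R)).
    apply/funext => -[|N]; first by rewrite /div_index expr1 invr0 mulr0.
    by rewrite /div_index /psum big_ord_recl big1 ?addr0 ?mul1r.
  exact: polylog_coef_log.
have -> : (fun N => (N%:R ^+ k.+2)^-1) =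
    div_index (fun N => (N%:R ^+ k.+1)^-1 : R).
  by apply/funext => N; rewrite /div_index exprSr invfM.
exact: polylog_coef_div.
Qed.

Lemma conv_at0 (R : realType) (F g : nat -> R) N : g 0%N = 0 ->
  conv F g N = \sum_(s < N) F s * g (N - s)%N.
Proof. by move=> g0; rewrite /conv big_ord_recr/= subnn g0 mulr0 addr0. Qed.

Lemma push_gap (R : realType) (F : nat -> R) k : (1 <= k)%N ->
  push (gap_kernel R) F k = div_index (conv F (fun N => (N%:R ^+ k)^-1)).
Proof.
move=> k1; apply/funext => N.
rewrite /div_index conv_at0 ?expr0n ?gtn_eqF ?invr0//.
by rewrite mulr_suml; apply: eq_bigr => s _; rewrite mulrA.
Qed.

Lemma push_cumulative_gap (R : realType) (F : nat -> R) k : (1 <= k)%N ->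
  push (cumulative_gap_kernel R) F k =
  div_index (psum (conv F (fun N => (N%:R ^+ k)^-1))).
Proof.
move=> k1; rewrite convC -conv_psum convC; apply/funext => N.
rewrite /div_index conv_at0 ?psum0//.
by rewrite mulr_suml; apply: eq_bigr => s _; rewrite mulrA.
Qed.

Lemma polylog_coef_conv_power (R : realType) (F : nat -> R) k : (1 <= k)%N ->
  F = delta_zero R \/ polylog_coef F ->
    polylog_coef (conv F (fun N => (N%:R ^+ k)^-1)).
Proof.
move=> k1 [->|PF]; last exact: polylog_coef_conv (polylog_coef_power R k1).
by rewrite conv_delta_zero; exact: polylog_coef_power.
Qed.

Lemma pushes_gap (R : realType) ks k : all (leq 1) ks -> (1 <= k)%N ->
  exists2 f, polylog_coef f &
    pushes (gap_kernel R) (delta_zero R) (rcons ks k) = div_index f.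
Proof.
move=> + k1; elim/last_ind: ks k k1 => [|ks j IH] k k1 ks1.
  rewrite pushes_rcons push_gap//; eexists; last by [].
  by apply: polylog_coef_conv_power => //; left.
rewrite pushes_rcons push_gap//; eexists; last by [].
apply: polylog_coef_conv_power => //; right.
move: ks1; rewrite all_rcons => /andP[j1 ks1].
by have [f Pf ->] := IH j j1 ks1; exact: polylog_coef_div.
Qed.

Lemma pushes_cumulative_gap (R : realType) ks k : all (leq 1) ks ->
  (1 <= k)%N ->
  polylog_coef (pushes (cumulative_gap_kernel R) (delta_zero R) (rcons ks k)).
Proof.
move=> + k1; elim/last_ind: ks k k1 => [|ks j IH] k k1 ks1.
  rewrite pushes_rcons push_cumulative_gap//; apply: polylog_coef_psum.
  by apply: polylog_coef_conv_power => //; left.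
rewrite pushes_rcons push_cumulative_gap//; apply: polylog_coef_psum.
apply: polylog_coef_conv_power => //; right.
by move: ks1; rewrite all_rcons => /andP[j1 ks1]; exact: IH.
Qed.

Lemma summable_fine (R : realType) (T : choiceType) (D : set T)
    (a : T -> \bar R) (A : set R) :
  (forall t, 0 <= a t)%E ->
  (exists2 x : R, A x & (\esum_(t in D) a t = x%:E)%E) ->
  summable D a /\ A (fine (\esum_(t in D) a t)).
Proof.
move=> a0 [x Ax e]; rewrite e; split=> //; rewrite /summable.
by under eq_esum do rewrite gee0_abs//; rewrite e ltry.
Qed.

Lemma gap_series (R : realType) (r : nat) (k : r.-tuple nat) :
  (1 <= r)%N -> (forall i, (1 <= tnth k i)%N) ->
  exists2 x : R, mzv_algebra R x &
    (\esum_(n in [set n : r.-tuple nat | forall i, (1 <= tnth n i)%N])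
      (inv_powers R k n * (\prod_(j < r) (partial_sum n j)%:R)^-1)%:E = x%:E)%E.
Proof.
move=> r1 k1.
have : all (leq 1) k by apply/all_tnthP.
have := @esum_gaps R r k (fun=> 1%E) 0 (fun=> lee01).
under eq_esum do rewrite mule1.
move=> ->; rewrite transfers0//; last exact: gap_kernel_ge0.
case/lastP: (tval k) (size_tuple k) => [r0|ks j _]; first by rewrite -r0 in r1.
rewrite all_rcons => /andP[j1 ks1].
have [f Pf ->] := pushes_gap R ks1 j1.
by under eq_esum do rewrite mule1; exact: esum_polylog_coef.
Qed.

Lemma partial_sum_last r (m : r.-tuple nat) :
  partial_sum m r.-1 = (\sum_(i < r) tnth m i)%N.
Proof.
rewrite /partial_sum big_mkcond; apply: eq_bigr => i _.
by rewrite ifT// -ltnS prednK// (leq_ltn_trans _ (ltn_ord i)).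
Qed.

(** The square of the last partial sum is split: one factor belongs to the
    kernel of the last step, the other is the weight on the end of
    the chain. *)
Lemma cumulative_gap_series (R : realType) (r : nat) (k : r.-tuple nat) :
  (1 <= r)%N -> (forall i, (1 <= tnth k i)%N) ->
  exists2 x : R, mzv_algebra R x &
    (\esum_(nm in [set nm : r.-tuple nat * r.-tuple nat |
        forall i, (1 <= tnth nm.1 i)%N /\ (tnth nm.1 i < tnth nm.2 i)%N])
      (inv_powers R k nm.1 *
        ((\prod_(0 <= j < r.-1) (partial_sum nm.2 j)%:R) *
         (partial_sum nm.2 r.-1)%:R ^+ 2)^-1)%:E = x%:E)%E.
Proof.
move=> r1 k1.
have : all (leq 1) k by apply/all_tnthP.
have := @esum_cumulative_gaps R r k (fun N => (N%:R^-1)%:E) 0 k1.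
rewrite (eq_esum (b := fun nm => (inv_powers R k nm.1 *
        ((\prod_(0 <= j < r.-1) (partial_sum nm.2 j)%:R) *
         (partial_sum nm.2 r.-1)%:R ^+ 2)^-1)%:E)); last first.
  move=> nm _; rewrite -EFinM -mulrA -invfM; congr (_ * _^-1)%:E.
  rewrite expr2 mulrA add0n -partial_sum_last; congr (_ * _).
  rewrite -(big_mkord xpredT (fun j => (partial_sum nm.2 j)%:R)).
  by rewrite -{1}(prednK r1) big_nat_recr.
move=> ->; last by move=> n; rewrite lee_fin invr_ge0.
rewrite transfers0//; last exact: cumulative_gap_kernel_ge0.
case/lastP: (tval k) (size_tuple k) => [r0|ks j _]; first by rewrite -r0 in r1.
rewrite all_rcons => /andP[j1 ks1].
under eq_esum do rewrite -EFinM.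
by apply: esum_polylog_coef; exact: pushes_cumulative_gap.
Qed.

(** * The connected double series *)

Lemma esum_pair (R : realType) (T1 T2 : choiceType) (I : set T1) (J : set T2)
    (a : T1 * T2 -> \bar R) : (forall x, 0 <= a x)%E ->
  (\esum_(n in [set n | I n.1 /\ J n.2]) a n =
   \esum_(x in I) \esum_(y in J) a (x, y))%E.
Proof.
move=> a0; rewrite (@esum_esum _ _ _ I (fun=> J) (fun x y => a (x, y)))//.
by apply: eq_esum => -[].
Qed.

(** The factors 1 / b are moved one by one to the other side of the connector,
    where each becomes a new index above a; the last one is summed out and
    raises the exponent of the largest index by 1. *)
Lemma connected_series (R : realType) (k l : nat) : (1 <= l)%N ->
  (\esum_(n in [set n : nat * nat | (1 <= n.1)%N /\ (1 <= n.2)%N])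
     ((n.1%:R ^+ k * n.2%:R ^+ l)^-1 * fact_ratio R n.1 n.2)%:E =
   transfers (zeta_kernel R)
     (if (2 <= l)%N then k.+1 :: rcons (nseq (l - 2) 1%N) 2%N else [:: k.+2])
     (fun=> 1) 0)%E.
Proof.
move=> l1; pose K := zeta_kernel R.
have C0 a b : (0 <= ((b%:R ^+ l)^-1 * connector R a b)%:E)%E.
  by rewrite lee_fin mulr_ge0 ?connector_ge0// invr_ge0 exprn_ge0.
rewrite (@esum_pair _ _ _ [set a | (1 <= a)%N] [set b | (1 <= b)%N]);
  last first.
  move=> n; rewrite lee_fin mulr_ge0//.
  by rewrite divr_ge0// prodr_ge0.
transitivity (transfer K k.+1 (fun a => \esum_(b in [set b | (0 < b)%N])
    ((b%:R ^+ l)^-1 * connector R a b)%:E) 0)%E.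
  apply: eq_esum => a /= a1; rewrite -esumZl ?zeta_kernel_ge0//.
  apply: eq_esum => b /= b1; rewrite fact_ratioE// -EFinM /K /zeta_kernel.
  by rewrite exprSr !invfM; congr EFin; rewrite !mulrA; congr (_ * _);
    rewrite mulrAC.
case: ifPn => [l2|]; last first.
  rewrite -ltnNge ltnS => l1'.
  have -> : l = 1%N by apply/eqP; rewrite eqn_leq l1' l1.
  apply: eq_esum => a /= a1; under eq_esum do rewrite expr1 connectorC.
  rewrite transport// connector0 mulr1 mule1 -EFinM /K /zeta_kernel.
  by rewrite [in RHS]exprSr invfM.
apply: eq_esum => a _; congr (_ * _)%E.
by have := @transfers_ones_two R (l - 2) a; rewrite subnK// => <-.
Qed.

(** Attaching the connector C(a, .) to the chain m_1 < ... < m_l, each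
    [transport] removes the top index and leaves a factor 1 / a. *)
Lemma zeta_connected_series (R : realType) (k l : nat) :
  (transfers (zeta_kernel R) [:: (k + l + 1)%N] (fun=> 1) 0 =
   \esum_(n in [set n : nat * l.-tuple nat |
                      (1 <= n.1)%N /\ increasing_indices l n.2])
          ((n.1%:R ^+ k * \prod_(i < l) (tnth n.2 i)%:R)^-1 *
           fact_ratio R n.1 (last 0%N n.2))%:E)%E.
Proof.
rewrite (@esum_pair _ _ _ [set a | (1 <= a)%N] (increasing_indices l));
  last first.
  move=> n; rewrite lee_fin mulr_ge0//.
    by rewrite invr_ge0 mulr_ge0// ?exprn_ge0// prodr_ge0.
  by rewrite divr_ge0// prodr_ge0.
apply: eq_esum => a /= a1.
pose ones := [tuple of nseq l 1%N].
have C0 n : (0 <= (connector R a n)%:E)%E by rewrite lee_fin connector_ge0.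
transitivity ((a%:R ^+ k.+1)^-1%:E *
   transfers (zeta_kernel R) ones (fun c => (connector R a c)%:E) 0)%E.
  have -> : (fun c => (connector R a c)%:E) = (fun c => (connector R c a)%:E).
    by apply/funext => c; rewrite connectorC.
  rewrite transfers_connector// connector0 mulr1 mule1 -EFinM -invfM -exprD.
  by rewrite /zeta_kernel addn1 addSn.
rewrite -esum_increasing// -esumZl ?invr_ge0 ?exprn_ge0//; last first.
  by move=> n; rewrite mule_ge0// lee_fin inv_powers_ge0.
apply: eq_esum => n _; rewrite fact_ratioE// -!EFinM exprSr !invfM.
have -> : inv_powers R ones n = (\prod_(i < l) (tnth n i)%:R)^-1.
  by rewrite /inv_powers -prodfV; apply: eq_bigr => i _;
    rewrite tnth_nseq expr1.
by congr EFin; rewrite !mulrA; congr (_ * _); rewrite mulrAC.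
Qed.

Theorem theorem1p4 (R : realType) :
  [/\ (mzv R [tuple 3%N])%:E =
        \esum_(n in [set n : nat * nat | (1 <= n.1)%N /\ (1 <= n.2)%N])
          ((n.1%:R * n.2%:R)^-1 * fact_ratio R n.1 n.2)%:E,
      forall k l : nat, (1 <= k)%N -> (1 <= l)%N ->
        \esum_(n in [set n : nat * nat | (1 <= n.1)%N /\ (1 <= n.2)%N])
          ((n.1%:R ^+ k * n.2%:R ^+ l)^-1 * fact_ratio R n.1 n.2)%:E =
        (if (2 <= l)%N
         then mzv R [tuple of (k + 1)%N :: rcons (nseq (l - 2) 1%N) 2%N]
         else mzv R [tuple (k + 2)%N])%:E
    & forall k l : nat, (1 <= k)%N -> (1 <= l)%N ->
        (mzv R [tuple (k + l + 1)%N])%:E =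
        \esum_(n in [set n : nat * l.-tuple nat |
                      (1 <= n.1)%N /\ increasing_indices l n.2])
          ((n.1%:R ^+ k * \prod_(i < l) (tnth n.2 i)%:R)^-1 *
           fact_ratio R n.1 (last 0%N n.2))%:E]
  /\
  (forall (r : nat) (k : r.-tuple nat),
     (1 <= r)%N -> (forall i, (1 <= tnth k i)%N) ->
     let D1 := [set n : r.-tuple nat | forall i, (1 <= tnth n i)%N] in
     let f1 := fun n : r.-tuple nat =>
       (inv_powers R k n * (\prod_(j < r) (partial_sum n j)%:R)^-1)%:E in
     let D2 := [set nm : r.-tuple nat * r.-tuple nat |
                 forall i, (1 <= tnth nm.1 i)%N /\
                           (tnth nm.1 i < tnth nm.2 i)%N] in
     let f2 := fun nm : r.-tuple nat * r.-tuple nat =>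
       (inv_powers R k nm.1 *
        ((\prod_(0 <= j < r.-1) (partial_sum nm.2 j)%:R) *
         (partial_sum nm.2 r.-1)%:R ^+ 2)^-1)%:E in
     [/\ summable D1 f1,
         mzv_algebra R (fine (\esum_(n in D1) f1 n)),
         summable D2 f2 &
         mzv_algebra R (fine (\esum_(nm in D2) f2 nm))]).
Proof.
have double k l : (1 <= k)%N -> (1 <= l)%N ->
    (\esum_(n in [set n : nat * nat | (1 <= n.1)%N /\ (1 <= n.2)%N])
      ((n.1%:R ^+ k * n.2%:R ^+ l)^-1 * fact_ratio R n.1 n.2)%:E =
    (if (2 <= l)%N
     then mzv R [tuple of (k + 1)%N :: rcons (nseq (l - 2) 1%N) 2%N]
     else mzv R [tuple (k + 2)%N])%:E)%E.
  move=> k1 l1; rewrite connected_series// addn1 addn2.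
  case: ifP => l2; rewrite mzv_transfers//.
    split=> //; last by rewrite /= last_rcons.
    apply/all_tnthP; rewrite /= all_rcons/=.
    by apply/allP => i /nseqP[->].
  by split=> //; apply/all_tnthP.
split; first split.
- have := double 1%N 1%N isT isT => /= <-; apply: eq_esum => n _.
  by rewrite !expr1.
- exact: double.
- move=> k l k1 l1; rewrite mzv_transfers; first exact: zeta_connected_series.
  split=> // [|/=]; first by apply/all_tnthP; rewrite /= addn1.
  by rewrite addn1 ltnS (leq_trans k1)// leq_addr.
move=> r k r1 k1 /=.
have [] := summable_fine _ (gap_series R r1 k1).
  move=> n; rewrite lee_fin mulr_ge0 ?inv_powers_ge0// invr_ge0.
  by rewrite prodr_ge0.
have [] := summable_fine _ (cumulative_gap_series R r1 k1).
  move=> n; rewrite lee_fin mulr_ge0 ?inv_powers_ge0// invr_ge0.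
  by rewrite mulr_ge0 ?prodr_ge0// exprn_ge0.
by [].
Qed.
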